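(* Let $r,n$ be positive integers and $c>0$ with $cn$ an integer. Let $G$ be a tripartite graph with parts $V_0,V_1,V_2$, where $|V_1|=|V_2|=n$, $|V_0|=cn$, and every vertex of $V_1$ is adjacent to every vertex of $V_2$. Suppose the edges of $G$ are colored with $r$ colors in such a way that there is a collection of $n^2$ pairwise edge-disjoint monochromatic triangles of $G$ which cover all edges between $V_1$ and $V_2$. Then $G$ contains at least $(4cr)^{-2^{r+3}}n^3$ monochromatic triangles.
   Context: A tripartite graph with parts $V_0,V_1,V_2$ has no edges inside any part. A triangle is monochromatic if all three of its edges receive the same color. *)

(* Defs.v *)
From HB Require Import structures.
From mathcomp Require Import all_boot all_order all_algebra.
Set Implicit Arguments.
Unset Strict Implicit.
Unset Printing Implicit Defensive.

Section Graph.
Variables (T : finType) (e : rel T).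

Definition simple_graph : Prop := symmetric e /\ irreflexive e.

Definition edges : {set {set T}} :=
  [set [set p.1; p.2] | p : T * T & e p.1 p.2].

Definition edges_between (A B : {set T}) : {set {set T}} :=
  [set [set p.1; p.2] | p : T * T & [&& p.1 \in A, p.2 \in B & e p.1 p.2]].

Definition independent (A : {set T}) : Prop :=
  forall x y : T, x \in A -> y \in A -> ~~ e x y.

Definition tripartite (V0 V1 V2 : {set T}) : Prop :=
  [/\ V0 :|: V1 :|: V2 = [set: T],
      [/\ [disjoint V0 & V1], [disjoint V0 & V2] & [disjoint V1 & V2]]
    & [/\ independent V0, independent V1 & independent V2]].

(* A triangle is identified with its set of three vertices. *)
Definition triangle (t : {set T}) : bool :=
  (#|t| == 3) && [forall x in t, forall y in t, (x != y) ==> e x y].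

Definition triangle_edges (t : {set T}) : {set {set T}} :=
  [set f in edges | f \subset t].

(* A coloring is a total function on vertex sets, of which only the values on
   [edges] are ever used. *)
Definition monochromatic (r : nat) (col : {set T} -> 'I_r) (t : {set T})
  : bool :=
  [forall f in triangle_edges t, forall g in triangle_edges t, col f == col g].

Definition mono_triangles (r : nat) (col : {set T} -> 'I_r) : {set {set T}} :=
  [set t | triangle t && monochromatic col t].

Definition edge_disjoint (S : {set {set T}}) : Prop :=
  forall t u : {set T}, t \in S -> u \in S -> t != u ->
    [disjoint triangle_edges t & triangle_edges u].

End Graph.

(* Main.v *)
Require Import Defs.
From HB Require Import structures.
From mathcomp Require Import all_boot all_order all_algebra.
From mathcomp Require Import zify ring lra.
Set Implicit Arguments.
Unset Strict Implicit.
Unset Printing Implicit Defensive.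
Import Order.TTheory GRing.Theory Num.Theory.
Local Open Scope ring_scope.

(** The given triangles define a Latin-type map [phi : V1 * V2 -> V0], injective
    in each argument, such that x, y and [phi x y] span a monochromatic triangle.
    For a color i and z in V0, the pairs (x, y) of color i with [phi x y = z] form
    a matching between sets X_z and Y_z, and every edge of color i in X_z * Y_z
    closes a monochromatic triangle with z.  If there are few monochromatic
    triangles, then by averaging over z, starting from a popular color i in a
    subgrid X * Y in which the colors of J are rare, one finds a z such that X_z
    is still large and the colors of J and i are rare in X_z * Y_z.  After r steps
    all colors are rare in a nonempty subgrid, which is absurd.  With K = 4cr,
    after j steps the subgrid has side at least n K^(1 - 2^j), and the density of
    the rare colors is at most K^(3 (2^j - 1)) times the normalised number of
    monochromatic triangles. *)

(** * Double counting, averaging and the arithmetic of one step *)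

Lemma sum_card_fibers (I P : finType) (F : I -> {set P}) :
  (\sum_(i : I) #|F i| = #|[set q : P * I | q.1 \in F q.2]|)%N.
Proof.
rewrite -sum1_card (eq_bigl (fun q : P * I => q.1 \in F q.2)); last first.
  by move=> q; rewrite inE.
rewrite -(pair_big_dep xpredT (fun p i => p \in F i) (fun _ _ => 1%N)) /=.
rewrite (exchange_big_dep xpredT) //=.
by apply: eq_bigr => i _; rewrite sum1_card.
Qed.

Lemma sum_leq_exists (I : finType) (P : {set I}) (f g : I -> nat) :
  P != set0 -> (\sum_(i in P) f i <= \sum_(i in P) g i)%N ->
  exists2 i, i \in P & (f i <= g i)%N.
Proof.
move=> /set0Pn[i0 Pi0] le_fg; apply/exists_inP; apply: contraLR le_fg.
move=> /exists_inPn no; rewrite -ltnNge (bigD1 i0) //= [X in (_ < X)%N](bigD1 i0) //=.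
have := no i0 Pi0; rewrite -ltnNge => lt0.
apply: (leq_trans (n := (f i0 + \sum_(i in P | i != i0) g i)%N)).
  by rewrite -addSn leq_add2r.
rewrite leq_add2l; apply: leq_sum => i /andP[Pi _].
by have := no i Pi; rewrite -ltnNge => /ltnW.
Qed.

(* Substituting the bounds on [N] and [bad] produces the factor [2 s^4 k^2],
   which [s^6 k^3] absorbs. *)
Lemma density_step (R : realFieldType) (k m m' bad bad' M s N : R) :
  0 < m -> 0 <= m' -> 0 <= bad -> 0 <= M -> 1 <= s -> 0 < N ->
  N <= m * s -> bad * N ^+ 3 <= M * s ^+ 3 * m ^+ 2 ->
  4%:R <= k ->
  bad' * m ^+ 4 <= (bad * m + M) * (k ^+ 2 * N) * m' ^+ 2 ->
  bad' * N ^+ 3 <= M * (s ^+ 2 * k) ^+ 3 * m' ^+ 2.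
Proof.
move=> m_gt0 m'_ge0 bad_ge0 M_ge0 s_ge1 N_gt0 leN le_bad k_ge4 le_bad'.
have m4_gt0 : 0 < m ^+ 4 by rewrite exprn_gt0.
rewrite -(ler_pM2r m4_gt0).
have leN3 : N ^+ 3 <= (m * s) ^+ 3 by rewrite lerXn2r ?nnegrE //; nra.
have step1 : bad' * N ^+ 3 * m ^+ 4
    <= (bad * N ^+ 3 * m + M * N ^+ 3) * (k ^+ 2 * N) * m' ^+ 2.
  have := ler_wpM2r (exprn_ge0 3 (ltW N_gt0)) le_bad'.
  by congr (_ <= _); ring.
apply: (le_trans step1).
(* Each summand is at most M s^3 m^3: the first by the density bound, the second by N <= m s. *)
have inner : bad * N ^+ 3 * m + M * N ^+ 3 <= 2%:R * M * s ^+ 3 * m ^+ 3.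
  have e1 := ler_wpM2r (ltW m_gt0) le_bad.
  have e2 := ler_wpM2l M_ge0 leN3.
  apply: (le_trans (lerD e1 e2)).
  by rewrite le_eqVlt; apply/orP; left; apply/eqP; ring.
have q_ge0 : 0 <= k ^+ 2 * m' ^+ 2 by rewrite mulr_ge0 ?sqr_ge0.
apply: (le_trans (y := 2%:R * M * s ^+ 3 * m ^+ 3 * (k ^+ 2 * (m * s)) * m' ^+ 2)).
  rewrite ler_wpM2r ?sqr_ge0 //; apply: ler_pM => //.
  - by rewrite addr_ge0 // !mulr_ge0 // ?exprn_ge0 ?ltW.
  - by rewrite mulr_ge0 ?sqr_ge0 ?ltW.
  - by rewrite ler_wpM2l ?sqr_ge0.
rewrite -subr_ge0.
have -> : M * (s ^+ 2 * k) ^+ 3 * m' ^+ 2 * m ^+ 4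
    - 2%:R * M * s ^+ 3 * m ^+ 3 * (k ^+ 2 * (m * s)) * m' ^+ 2
  = M * m ^+ 4 * s ^+ 4 * (k ^+ 2 * m' ^+ 2) * (s ^+ 2 * k - 2%:R) by ring.
have s_ge0 : 0 <= s by lra.
have k_ge0 : 0 <= k by lra.
rewrite !mulr_ge0 ?sqr_ge0 ?exprn_ge0 ?(ltW m_gt0) //.
have s2_ge1 : 1 <= s ^+ 2 by rewrite exprn_ege1.
rewrite subr_ge0; nra.
Qed.

(** * Color classes and fibers in a Latin rectangle *)

Section LatinColoring.

Variables (A B C : finType) (r : nat) (phi : A -> B -> C) (chi : A -> B -> 'I_r).
Hypothesis phi_injr : forall a, injective (phi a).
Hypothesis phi_injl : forall b, injective (phi^~ b).
Implicit Types (X : {set A}) (Y : {set B}) (J : {set 'I_r}) (i : 'I_r) (z : C).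

(* The entry [phi a b] of the Latin rectangle is the third vertex of the given
   triangle on the edge ab, and [chi a b] is the color of that edge. *)
Definition mono_triples : {set A * B * C} :=
  [set t | [exists b, (phi t.1.1 b == t.2) && (chi t.1.1 b == chi t.1.1 t.1.2)]
        && [exists a, (phi a t.1.2 == t.2) && (chi a t.1.2 == chi t.1.1 t.1.2)]].

Definition colored_in (X : {set A}) (Y : {set B}) J : {set A * B} :=
  [set p in setX X Y | chi p.1 p.2 \in J].

Definition color_fiber X Y (i : 'I_r) (z : C) : {set A * B} :=
  [set p in colored_in X Y [set i] | phi p.1 p.2 == z].

Definition fiber_left X Y i z : {set A} := fst @: color_fiber X Y i z.
Definition fiber_right X Y i z : {set B} := snd @: color_fiber X Y i z.

Lemma color_fiberP X Y i z p :
  reflect [/\ p.1 \in X, p.2 \in Y, chi p.1 p.2 = i & phi p.1 p.2 = z]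
          (p \in color_fiber X Y i z).
Proof.
rewrite !inE; apply: (iffP andP) => [[/andP[/andP[-> ->] /eqP->] /eqP->]|] //.
by case=> -> -> -> ->; rewrite !eqxx.
Qed.

(** A row of [phi] takes the value z at most once, so the fiber is a matching and projects
    injectively to either side. *)
Lemma card_fiber_left X Y i z : #|fiber_left X Y i z| = #|color_fiber X Y i z|.
Proof.
apply: card_in_imset => -[a b] [a' b'] /color_fiberP[/= _ _ _ zab].
move=> /color_fiberP[/= _ _ _ zab'] /= eqa; rewrite -eqa -zab in zab' *.
by rewrite (phi_injr zab').
Qed.

Lemma card_fiber_right X Y i z : #|fiber_right X Y i z| = #|color_fiber X Y i z|.
Proof.
apply: card_in_imset => -[a b] [a' b'] /color_fiberP[/= _ _ _ zab].
move=> /color_fiberP[/= _ _ _ zab'] /= eqb; rewrite -eqb -zab in zab' *.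
by rewrite (phi_injl zab').
Qed.

Lemma sum_card_color_fiber X Y i :
  (\sum_z #|color_fiber X Y i z| = #|colored_in X Y [set i]|)%N.
Proof.
rewrite -sum1_card (partition_big (fun p => phi p.1 p.2) xpredT) //=.
by apply: eq_bigr => z _; rewrite -sum1_card; apply: eq_bigl => p; rewrite !inE.
Qed.

(* A pair (a, b) lies in the subgrid of [z] only if [z] is in the row of [a]. *)
Lemma sum_colored_fiber_old X Y i J :
  (\sum_z #|colored_in (fiber_left X Y i z) (fiber_right X Y i z) J|
     <= #|colored_in X Y J| * #|Y|)%N.
Proof.
rewrite sum_card_fibers -sum_nat_const.
rewrite -sum1_card (partition_big fst (mem (colored_in X Y J))) /=; last first.
  move=> [[a b] z]; rewrite !inE /= => /andP[/andP[]].
  case/imsetP=> p /color_fiberP[Xp _ _ _] ->.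
  by case/imsetP=> q /color_fiberP[_ Yq _ _] -> ->; rewrite Xp Yq.
apply: leq_sum => p _; rewrite sum1dep_card.
pose g (b : B) := (p, phi p.1 b).
apply: leq_trans (leq_imset_card g Y); apply: subset_leq_card.
apply/subsetP=> -[q z]; rewrite !inE /= => /andP[/andP[/andP[+ _] _] /eqP eqp].
rewrite {q}eqp; case/imsetP=> q /color_fiberP[_ Yq _ phiq] eq1.
by apply/imsetP; exists q.2 => //; rewrite /g eq1 phiq.
Qed.

(** If ab has color i inside the subgrid of z, then a and b each lie in a cell of color i with value
    z. These two cells supply the witnesses that put (a, b, z) in [mono_triples]. *)
Lemma sum_colored_fiber_new X Y i :
  (\sum_z #|colored_in (fiber_left X Y i z) (fiber_right X Y i z) [set i]|
     <= #|mono_triples|)%N.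
Proof.
rewrite sum_card_fibers; apply: subset_leq_card; apply/subsetP=> -[[a b] z].
rewrite !inE /= => /andP[/andP[]].
case/imsetP=> -[a1 b1] /color_fiberP[/= _ _ chi1 phi1] /= ->.
case/imsetP=> -[a2 b2] /color_fiberP[/= _ _ chi2 phi2] /= -> /eqP chi12.
apply/andP; split; apply/existsP.
  by exists b1; rewrite phi1 chi1 chi12 !eqxx.
by exists a2; rewrite phi2 chi2 chi12 !eqxx.
Qed.

Lemma colored_inU1 X Y i J :
  (#|colored_in X Y (i |: J)| <= #|colored_in X Y [set i]| + #|colored_in X Y J|)%N.
Proof.
rewrite (_ : colored_in X Y (i |: J) = colored_in X Y [set i] :|: colored_in X Y J).
  by rewrite cardsU leq_subr.
by apply/setP=> p; rewrite !inE andb_orr.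
Qed.

(** At least half of the cells avoid [J], and at most [r] colors share them. *)
Lemma popular_color X Y J m :
  (0 < m)%N -> #|X| = m -> #|Y| = m -> (2 * #|colored_in X Y J| <= m ^ 2)%N ->
  exists2 i, i \notin J & (m ^ 2 <= 2 * r * #|colored_in X Y [set i]|)%N.
Proof.
move=> m_gt0 cX cY leJ.
have split_count : (m ^ 2 = #|colored_in X Y J| + \sum_(i in ~: J) #|colored_in X Y [set i]|)%N.
  have -> : (m ^ 2 = #|setX X Y|)%N by rewrite cardsX cX cY mulnn.
  rewrite -(cardsID (colored_in X Y J) (setX X Y)); congr (_ + _)%N.
    congr #|pred_of_set _|; apply/setP=> p; rewrite !inE.
    by case: (p.1 \in X); case: (p.2 \in Y).
  rewrite -sum1_card (partition_big (fun p => chi p.1 p.2) (mem (~: J))) /=.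
    apply: eq_bigr => i; rewrite inE => iJ; rewrite -sum1_card; apply: eq_bigl => p.
    rewrite !inE; case: (p.1 \in X); case: (p.2 \in Y); rewrite ?andbT ?andbF //=.
    by case: eqP => [->|]; rewrite ?iJ ?andbT ?andbF.
  by move=> p; rewrite !inE; case: (p.1 \in X); case: (p.2 \in Y); rewrite ?andbT ?andbF.
have m2_gt0 : (0 < m ^ 2)%N by rewrite expn_gt0 m_gt0.
(* If [J] held all colors, its cells would fill the whole grid instead of at most half. *)
have nonempty : ~: J != set0.
  by apply: contraTneq m2_gt0 => J0; move: split_count; rewrite J0 big_set0; lia.
have [|i iJ le_i] := sum_leq_exists (f := fun=> (m ^ 2)%N)
    (g := fun i => (2 * r * #|colored_in X Y [set i]|)%N) nonempty.
  rewrite sum_nat_const -big_distrr /=.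
  have cJ : (#|~: J| <= r)%N by have := max_card (mem (~: J)); rewrite card_ord.
  apply: (leq_trans (n := (r * m ^ 2)%N)); first by rewrite leq_mul2r cJ orbT.
  move: split_count leJ; set s := (\sum_(i in ~: J) _)%N => split_count leJ.
  have -> : (2 * r * s = r * (2 * s))%N by ring.
  by rewrite leq_mul2l; apply/orP; right; lia.
by exists i => //; rewrite inE in iJ.
Qed.

(* A value [z] is kept in [L] if its fiber has at least half the average size.
   These fibers carry half of the color class, so sum_(z in L) w z ^ 2 is at
   least m ^ 4 / (16 r ^ 2 #|C|), and averaging against [sumW] gives [z]. *)
Lemma restrict_to_fiber X Y J m :
  (0 < m)%N -> #|X| = m -> #|Y| = m -> (2 * #|colored_in X Y J| <= m ^ 2)%N ->
  exists i X' Y', [/\ i \notin J, #|X'| = #|Y'|,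
    (m ^ 2 <= 4 * r * #|C| * #|X'|)%N &
    (#|colored_in X' Y' (i |: J)| * m ^ 4 <=
       (#|colored_in X Y J| * m + #|mono_triples|) * (16 * r ^ 2 * #|C|) * #|X'| ^ 2)%N].
Proof.
move=> m_gt0 cX cY leJ; have [i iJ le_i] := popular_color m_gt0 cX cY leJ.
pose w z := #|color_fiber X Y i z|.
pose L := [set z | (m ^ 2 <= 4 * r * #|C| * w z)%N].
have m2_gt0 : (0 < m ^ 2)%N by rewrite expn_gt0 m_gt0.
have C_gt0 : (0 < #|C|)%N.
  have /card_gt0P[a _] : (0 < #|X|)%N by rewrite cX.
  have /card_gt0P[b _] : (0 < #|Y|)%N by rewrite cY.
  by apply/card_gt0P; exists (phi a b).
(* Each of the at most |C| fibers outside [L] has fewer than m^2 / (4 r |C|) cells. *)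
have small : (4 * r * \sum_(z in ~: L) w z <= m ^ 2)%N.
  rewrite -(leq_pmul2l C_gt0).
  apply: (leq_trans (n := (\sum_(z in ~: L) m ^ 2)%N)); last first.
    by rewrite sum_nat_const leq_mul2r max_card orbT.
  rewrite mulnA big_distrr /=; apply: leq_sum => z; rewrite !inE -ltnNge.
  by move/ltnW; apply: leq_trans; rewrite (mulnC #|C|).
have large : (m ^ 2 <= 4 * r * \sum_(z in L) w z)%N.
  have total := sum_card_color_fiber X Y i.
  rewrite (bigID (mem L)) /= in total.
  have eqS : (\sum_(z | z \notin L) #|color_fiber X Y i z| = \sum_(z in ~: L) w z)%N.
    by apply: eq_bigl => z; rewrite in_setC.
  rewrite eqS -/w in total.
  rewrite -total in le_i; move: le_i small.
  set s1 := (\sum_(z in L) _)%N; set s2 := (\sum_(z in ~: L) _)%N.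
  rewrite -/s1 mulnDr.
  have -> : (4 * r * s2 = 2 * (2 * r * s2))%N by ring.
  have -> : (4 * r * s1 = 2 * (2 * r * s1))%N by ring.
  lia.
have L0 : L != set0.
  by apply: contraTneq m2_gt0 => L0; rewrite L0 big_set0 muln0 in large; lia.
pose W z := #|colored_in (fiber_left X Y i z) (fiber_right X Y i z) (i |: J)|.
(* Cells of color i are charged to monochromatic triples, cells with colors in [J] to the old rare
   cells. *)
have sumW : (\sum_(z in L) W z <= #|colored_in X Y J| * m + #|mono_triples|)%N.
  apply: (leq_trans (n := (\sum_z W z)%N)).
    by rewrite [X in (_ <= X)%N](bigID (mem L)) /= leq_addr.
  pose F z J' := #|colored_in (fiber_left X Y i z) (fiber_right X Y i z) J'|.
  apply: (leq_trans (n := (\sum_z (F z [set i] + F z J))%N)).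
    by apply: leq_sum => z _; apply: colored_inU1.
  rewrite big_split /= addnC leq_add ?sum_colored_fiber_new //.
  by rewrite -cY sum_colored_fiber_old.
set D := (_ + #|mono_triples|)%N in sumW *.
have [|z zL Wz] := sum_leq_exists (f := fun z => (W z * m ^ 4)%N)
    (g := fun z => (D * (16 * r ^ 2 * #|C|) * w z ^ 2)%N) L0.
  rewrite -big_distrl -big_distrr /=.
  apply: (leq_trans (n := (D * m ^ 4)%N)); first by rewrite leq_mul2r sumW orbT.
  rewrite -mulnA leq_mul2l; apply/orP; right.
  (* One factor m^2 of m^4 is bounded by [large]; the other is absorbed termwise, since m^2 w z <= 4
     r |C| (w z)^2 on [L]. *)
  apply: (leq_trans (n := (m ^ 2 * (4 * r * \sum_(z in L) w z))%N)).
    by rewrite (_ : 4 = 2 + 2)%N // expnD leq_mul2l large orbT.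
  rewrite mulnCA -mulnA.
  have -> : (16 * r ^ 2 * #|C| * \sum_(z in L) w z ^ 2 =
            4 * (r * (\sum_(z in L) (4 * r * #|C|) * w z ^ 2)))%N.
    by rewrite -big_distrr /=; ring.
  rewrite -mulnA leq_mul2l /= leq_mul2l; apply/orP; right.
  rewrite big_distrr /=; apply: leq_sum => z; rewrite inE => zL.
  by rewrite -(mulnn (w z)) !mulnA leq_mul2r zL orbT.
exists i, (fiber_left X Y i z), (fiber_right X Y i z); split=> //.
- by rewrite card_fiber_left card_fiber_right.
- by rewrite card_fiber_left; rewrite inE in zL.
- by rewrite card_fiber_left.
Qed.

(** * Iteration over the colors *)

Variables (R : realFieldType) (n : nat) (c : R).
Hypotheses (r_gt0 : (0 < r)%N) (n_gt0 : (0 < n)%N).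
Hypotheses (cardA : #|A| = n) (cardB : #|B| = n) (cardC : #|C|%:R = c * n%:R).

(** A single row of [phi] already has n distinct entries in [C]. Hence K >= 4, and powers of K grow
    with the exponent. *)
Lemma latin_ratio_ge1 : 1 <= c.
Proof.
have /card_gt0P[a _] : (0 < #|A|)%N by rewrite cardA.
have n_gt0R : 0 < n%:R :> R by rewrite ltr0n.
rewrite -(ler_pM2r n_gt0R) mul1r -cardC ler_nat -cardB.
exact: leq_card (phi_injr (a := a)).
Qed.

Local Notation K := (4%:R * c * r%:R).

Lemma K_ge4 : 4%:R <= K.
Proof.
have c1 := latin_ratio_ge1; have r1 : 1 <= r%:R :> R by rewrite ler1n.
by nra.
Qed.

Lemma K_ge1 : 1 <= K.
Proof. by have := K_ge4; lra. Qed.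

(** Each use of [restrict_to_fiber] turns the loss s = K^(2^j - 1) into s^2 K, whose exponent is 2
    (2^j - 1) + 1 = 2^(j+1) - 1. *)
Lemma sparse_subgrids (j : nat) : (j <= r)%N ->
  #|mono_triples|%:R * K ^+ (2 ^ (r + 3)) < n%:R ^+ 3 ->
  exists X Y J, [/\ #|J| = j, #|X| = #|Y|, (0 < #|X|)%N,
    n%:R <= #|X|%:R * K ^+ (2 ^ j - 1) &
    #|colored_in X Y J|%:R * n%:R ^+ 3
      <= #|mono_triples|%:R * (K ^+ (2 ^ j - 1)) ^+ 3 * #|X|%:R ^+ 2].
Proof.
move=> + few; have n_gt0R : 0 < n%:R :> R by rewrite ltr0n.
have K_ge0 : 0 <= K by have := K_ge4; lra.
have K_ge1 := K_ge1.
elim: j => [_|j IHj lt_jr].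
  exists setT, setT, set0; split.
  - by rewrite cards0.
  - by rewrite !cardsT cardA cardB.
  - by rewrite cardsT cardA.
  - by rewrite cardsT cardA expr0 mulr1.
  have -> : colored_in setT setT set0 = set0 by apply/setP=> p; rewrite !inE andbF.
  by rewrite cards0 mul0r !mulr_ge0 ?exprn_ge0.
have {IHj} [X [Y [J [cJ cXY X_gt0 leX leJ]]]] := IHj (ltnW lt_jr).
have m_gt0 : 0 < #|X|%:R :> R by rewrite ltr0n.
have P_gt0 : (0 < 2 ^ j)%N by rewrite expn_gt0.
(* By [few], the rare colors fill at most half of the grid, because 2 K^(3 (2^j - 1)) <= K^(3 (2^j -
   1) + 1) <= K^(2^(r + 3)). *)
have sparse : (2 * #|colored_in X Y J| <= #|X| ^ 2)%N.
  rewrite -(ler_nat R) natrM natrX -(ler_pM2r (exprn_gt0 3 n_gt0R)).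
  rewrite -mulrA; apply: (le_trans (ler_wpM2l _ leJ)); first by [].
  have -> : 2%:R * (#|mono_triples|%:R * (K ^+ (2 ^ j - 1)) ^+ 3 * #|X|%:R ^+ 2)
    = #|mono_triples|%:R * ((K ^+ (2 ^ j - 1)) ^+ 3 * 2%:R) * #|X|%:R ^+ 2 by ring.
  rewrite [leRHS]mulrC ler_wpM2r ?sqr_ge0 //.
  apply/ltW/(le_lt_trans _ few); rewrite ler_wpM2l //.
  rewrite -exprM; apply: (le_trans (y := K ^+ ((2 ^ j - 1) * 3).+1)).
    by rewrite exprSr ler_wpM2l ?exprn_ge0 //; have := K_ge4; lra.
  rewrite ler_weXn2l //.
  have : (2 ^ j <= 2 ^ r)%N by rewrite leq_exp2l // ltnW.
  by rewrite expnD; lia.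
have [i [X' [Y' [iJ cXY' geX' leJ']]]] :=
  restrict_to_fiber X_gt0 (erefl _) (esym cXY) sparse.
have X'_gt0 : (0 < #|X'|)%N.
  rewrite lt0n; apply: contraTneq geX' => ->; rewrite muln0.
  by rewrite -ltnNge expn_gt0 X_gt0.
exists X', Y', (i |: J); split=> //.
- by rewrite cardsU1 iJ cJ.
- move: geX'; rewrite -(ler_nat R) natrX !natrM cardC => geX'.
  have eK : K ^+ (2 ^ j.+1 - 1) = (K ^+ (2 ^ j - 1)) ^+ 2 * K.
    by rewrite -exprM -exprSr; congr (_ ^+ _); rewrite expnS; lia.
  (* Squaring n <= |X| s and inserting |X|^2 <= K n |X'| gives n^2 <= n |X'| s^2 K. *)
  rewrite eK -(ler_pM2l n_gt0R) -expr2.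
  apply: (le_trans (y := (#|X|%:R * K ^+ (2 ^ j - 1)) ^+ 2)).
    by rewrite lerXn2r ?nnegrE ?mulr_ge0 ?exprn_ge0 ?ler0n.
  rewrite exprMn.
  have -> : n%:R * (#|X'|%:R * ((K ^+ (2 ^ j - 1)) ^+ 2 * K))
     = (4%:R * r%:R * (c * n%:R) * #|X'|%:R) * (K ^+ (2 ^ j - 1)) ^+ 2.
    by ring.
  by rewrite ler_wpM2r ?sqr_ge0.
have eK : K ^+ (2 ^ j.+1 - 1) = (K ^+ (2 ^ j - 1)) ^+ 2 * K.
  by rewrite -exprM -exprSr; congr (_ ^+ _); rewrite expnS; lia.
rewrite eK; apply: (density_step (m := #|X|%:R) (bad := #|colored_in X Y J|%:R)) => //.
- by rewrite exprn_ege1.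
- exact: K_ge4.
move: leJ'; rewrite -(ler_nat R) !(natrM, natrD, natrX) cardC => leJ'.
apply: (le_trans leJ'); rewrite ler_wpM2r ?sqr_ge0 // ler_wpM2l //.
  by rewrite addr_ge0 ?mulr_ge0.
(* The fiber bound is linear in c while K^2 is quadratic; c >= 1 bridges the gap. *)
have -> : 16%:R * r%:R ^+ 2 * (c * n%:R) = 16%:R * r%:R ^+ 2 * n%:R * c by ring.
have -> : K ^+ 2 * n%:R = 16%:R * r%:R ^+ 2 * n%:R * (c * c) by ring.
have c_ge1 := latin_ratio_ge1.
by rewrite ler_wpM2l ?ler_peMl ?mulr_ge0 ?exprn_ge0 // (le_trans ler01).
Qed.

Theorem many_mono_triples :
  K ^- (2 ^ (r + 3)) * n%:R ^+ 3 <= #|mono_triples|%:R.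
Proof.
have K_gt0 : 0 < K by have := K_ge4; lra.
rewrite mulrC ler_pdivrMr ?exprn_gt0 //; case: leP => // few.
have [X [Y [J [cJ cXY X_gt0 _ leJ]]]] := sparse_subgrids (leqnn r) few.
(* Now every cell has a rare color, so |X|^2 cancels and n^3 <= M K^(3 (2^r - 1)), M being the
   number of monochromatic triples, against [few]. *)
have JT : J = setT by apply/eqP; rewrite eqEcard subsetT cardsT card_ord cJ leqnn.
have m2_gt0 : 0 < #|X|%:R ^+ 2 :> R by rewrite exprn_gt0 ?ltr0n.
have full : colored_in X Y J = setX X Y by apply/setP=> p; rewrite JT !inE andbT.
move: leJ; rewrite full cardsX -cXY natrM -expr2 mulrC ler_pM2r // => leJ.
suff : n%:R ^+ 3 < n%:R ^+ 3 :> R by rewrite ltxx.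
apply: (le_lt_trans leJ); apply: le_lt_trans few; rewrite ler_wpM2l //.
rewrite -exprM ler_weXn2l ?K_ge1 //.
by rewrite expnD; lia.
Qed.

End LatinColoring.

(** * Monochromatic triangles as vertex sets *)

Section GraphTriangles.

Variables (T : finType) (e : rel T) (r : nat) (col : {set T} -> 'I_r).
Hypothesis e_sym : symmetric e.

Lemma triangle_edgesP (t f : {set T}) :
  reflect (exists x y, [/\ x \in t, y \in t, e x y & f = [set x; y]])
          (f \in triangle_edges e t).
Proof.
rewrite !inE; apply: (iffP andP) => [[]|[x [y [tx ty exy ->]]]].
  case/imsetP=> -[x y] /=; rewrite inE /= => exy ->.
  by rewrite subUset !sub1set => /andP[tx ty]; exists x, y.
split; last by rewrite subUset !sub1set tx.
by apply/imsetP; exists (x, y); rewrite ?inE.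
Qed.

Lemma mem_triangle_edges (t : {set T}) x y :
  x \in t -> y \in t -> e x y -> [set x; y] \in triangle_edges e t.
Proof. by move=> tx ty exy; apply/triangle_edgesP; exists x, y. Qed.

Lemma triangle_adj (t : {set T}) x y :
  triangle e t -> x \in t -> y \in t -> x != y -> e x y.
Proof.
by case/andP=> _ /forall_inP adj tx ty; apply/implyP; have /forall_inP := adj x tx; apply.
Qed.

Lemma mono_triangle_col (t f g : {set T}) :
  t \in mono_triangles e col -> f \in triangle_edges e t -> g \in triangle_edges e t ->
  col f = col g.
Proof.
rewrite inE => /andP[_ /forall_inP mono] tf tg; apply/eqP.
by have /forall_inP := mono f tf; apply.
Qed.

Lemma mono_triangle_set3 x y z :
  irreflexive e -> e x y -> e x z -> e y z ->
  col [set x; z] = col [set x; y] -> col [set y; z] = col [set x; y] ->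
  [set x; y; z] \in mono_triangles e col.
Proof.
move=> irr exy exz eyz colxz colyz.
have neq u v : e u v -> u != v by move=> euv; apply: contraTneq euv => ->; rewrite irr.
have exy' := exy; have exz' := exz; have eyz' := eyz.
rewrite e_sym in exy'; rewrite e_sym in exz'; rewrite e_sym in eyz'.
rewrite inE /triangle; apply/andP; split.
  apply/andP; split.
    by rewrite setUC cardsU1 !inE cards2 !(eq_sym z) negb_or !neq.
  apply/forall_inP=> u; rewrite !inE => /orP[/orP[]|] /eqP->;
  by apply/forall_inP=> v; rewrite !inE => /orP[/orP[]|] /eqP->; rewrite ?eqxx //;
    apply/implyP.
have col_edge f : f \in triangle_edges e [set x; y; z] -> col f = col [set x; y].
  case/triangle_edgesP=> u [v [+ + + ->]]; rewrite !inE.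
  by case/orP=> [/orP[]|] /eqP-> /orP[/orP[]|] /eqP->; rewrite ?irr // setUC.
by apply/forall_inP=> f tf; apply/forall_inP=> g tg; rewrite !col_edge.
Qed.

End GraphTriangles.

(** * Passage from the graph to the Latin rectangle *)

Theorem theorem7p1 (R : realFieldType) (r n : nat) (c : R)
    (T : finType) (e : rel T) (V0 V1 V2 : {set T}) (col : {set T} -> 'I_r) :
  (0 < r)%N -> (0 < n)%N -> 0 < c ->
  simple_graph e ->
  tripartite e V0 V1 V2 ->
  #|V1| = n -> #|V2| = n -> #|V0|%:R = c * n%:R ->
  (forall x y : T, x \in V1 -> y \in V2 -> e x y) ->
  (exists S : {set {set T}},
     [/\ S \subset mono_triangles e col,
         #|S| = (n ^ 2)%N,
         edge_disjoint e S
       & forall f : {set T}, f \in edges_between e V1 V2 ->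
           exists2 t : {set T}, t \in S & f \in triangle_edges e t]) ->
  (4%:R * c * r%:R) ^- (2 ^ (r + 3)) * n%:R ^+ 3
    <= #|mono_triangles e col|%:R.
Proof.
move=> r_gt0 n_gt0 _ [sym irr] [cover [dis01 dis02 dis12] [ind0 ind1 ind2]].
move=> cV1 cV2 cV0 full [S [S_mono _ S_disj S_cover]].
have V01 x : x \in V0 -> x \in V1 -> False by move=> x0; rewrite (disjointFr dis01 x0).
have V02 x : x \in V0 -> x \in V2 -> False by move=> x0; rewrite (disjointFr dis02 x0).
have V12 x : x \in V1 -> x \in V2 -> False by move=> x1; rewrite (disjointFr dis12 x1).
(* The third vertex of a triangle of [S] on xy is adjacent to x and y, so independence of [V1] and
   [V2] forces it into [V0]. *)
have third x y : x \in V1 -> y \in V2 -> exists2 z, z \in V0 & [set x; y; z] \in S.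
  move=> x1 y2; have exy := full x y x1 y2.
  have neq_xy : x != y by apply: contraTneq exy => ->; rewrite irr.
  have [|t tS /triangle_edgesP[u [v [tu tv _ uv]]]] := S_cover [set x; y].
    by apply/imsetP; exists (x, y); rewrite ?inE //= x1 y2.
  have sub_t : [set x; y] \subset t by rewrite uv subUset !sub1set tu.
  have /[!inE] /andP[tri_t _] := subsetP S_mono t tS.
  have /andP[/eqP ct _] := tri_t.
  have /cards1P[z tz] : #|t :\: [set x; y]| == 1%N.
    by rewrite cardsD (setIidPr sub_t) ct cards2 neq_xy.
  have : z \in t :\: [set x; y] by rewrite tz set11.
  rewrite !inE negb_or => /andP[/andP[zx zy] z_t].
  have et : t = [set x; y; z] by rewrite -tz -{1}(setID t [set x; y]) (setIidPr sub_t).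
  exists z; last by rewrite -et.
  have : z \in V0 :|: V1 :|: V2 by rewrite cover inE.
  have xt : x \in t by rewrite (subsetP sub_t) // !inE eqxx.
  have yt : y \in t by rewrite (subsetP sub_t) // !inE eqxx orbT.
  rewrite !inE => /orP[/orP[//|z1]|z2].
    by have := ind1 _ _ z1 x1; rewrite (triangle_adj tri_t).
  by have := ind2 _ _ z2 y2; rewrite (triangle_adj tri_t).
pose A := {x | x \in V1}; pose B := {y | y \in V2}; pose C := {z | z \in V0}.
have ex_phi (p : A * B) : exists z : C, [set val p.1; val p.2; val z] \in S.
  have [z z0 zS] := third _ _ (valP p.1) (valP p.2).
  by exists (exist _ z z0).
have [phi2 phi2S] := fin_all_exists ex_phi.
pose phi (a : A) (b : B) : C := phi2 (a, b).
have phiS a b : [set val a; val b; val (phi a b)] \in S := phi2S (a, b).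
pose chi (a : A) (b : B) := col [set val a; val b].
have neqAB (a : A) (b : B) : val a != val b.
  by apply/eqP=> ab; apply: (V12 (val a)); rewrite ?(valP a) // ab (valP b).
have neqAC (a : A) (z : C) : val a != val z.
  by apply/eqP=> az; apply: (V01 (val a)); rewrite ?(valP a) // az (valP z).
have neqBC (b : B) (z : C) : val b != val z.
  by apply/eqP=> bz; apply: (V02 (val b)); rewrite ?(valP b) // bz (valP z).
have mono a b : [set val a; val b; val (phi a b)] \in mono_triangles e col.
  exact: subsetP S_mono _ (phiS a b).
have edges_phi a b : e (val a) (val (phi a b)) /\ e (val b) (val (phi a b)).
  have /[!inE] /andP[tri _] := mono a b.
  by split; apply: (triangle_adj tri); rewrite ?inE ?eqxx ?orbT.
have col_phi a b : col [set val a; val (phi a b)] = chi a b /\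
                   col [set val b; val (phi a b)] = chi a b.
  have [eaz ebz] := edges_phi a b.
  by split; apply: (mono_triangle_col (mono a b)); apply: mem_triangle_edges;
    rewrite ?inE ?eqxx ?orbT //; apply: full; apply: valP.
(* By edge-disjointness a triangle of [S] is determined by any one of its edges. *)
have share (t u f : {set T}) : t \in S -> u \in S ->
    f \in triangle_edges e t -> f \in triangle_edges e u -> t = u.
  move=> tS uS tf uf; apply/eqP; apply: contraTT tf => tu.
  by rewrite (disjointFl (S_disj t u tS uS tu) uf).
(* If b and b' give the same z, their triangles share the edge az and coincide; b is then a vertex
   of the second one, and the disjoint parts leave only b'. *)
have phi_injr a : injective (phi a).
  move=> b b' eqz; have := share _ _ [set val a; val (phi a b)] (phiS a b) (phiS a b').
  rewrite -eqz !mem_triangle_edges ?inE ?eqxx ?orbT //; try by case: (edges_phi a b).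
  move=> /(_ isT isT) /setP/(_ (val b)); rewrite !inE eqxx orbT /=.
  rewrite (negbTE (neqBC _ _)) (eq_sym (val b) (val a)) (negbTE (neqAB _ _)) orbF /=.
  by move/esym/eqP/val_inj.
have phi_injl b : injective (phi^~ b).
  move=> a a' /= eqz; have := share _ _ [set val b; val (phi a b)] (phiS a b) (phiS a' b).
  rewrite -eqz !mem_triangle_edges ?inE ?eqxx ?orbT //; try by case: (edges_phi a b).
  move=> /(_ isT isT) /setP/(_ (val a)); rewrite !inE eqxx /=.
  rewrite (negbTE (neqAC _ _)) (negbTE (neqAB _ _)) !orbF.
  by move/esym/eqP/val_inj.
have cA : #|{: A}| = n by rewrite card_sig -cV1; apply: eq_card.
have cB : #|{: B}| = n by rewrite card_sig -cV2; apply: eq_card.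
have cC : #|{: C}|%:R = c * n%:R by rewrite card_sig -cV0; congr _%:R; apply: eq_card.
apply: le_trans (many_mono_triples chi phi_injr phi_injl r_gt0 n_gt0 cA cB cC) _.
rewrite ler_nat.
(* Since the parts are disjoint, a vertex set determines its triple, so distinct triples yield
   distinct triangles. *)
pose F (q : A * B * C) := [set val q.1.1; val q.1.2; val q.2].
rewrite -(card_in_imset (f := F)) => [|[[a b] z] [[a' b'] z'] _ _ /setP eqF].
  apply/subset_leq_card/subsetP=> _ /imsetP[[[a b] z] + ->]; rewrite inE /=.
  case/andP=> /existsP[b' /andP[/eqP phib /eqP chib]].
  case/existsP=> a' /andP[/eqP phia /eqP chia]; rewrite /F /=.
  (* The edges az and bz come from two given triangles, on ab' and a'b, both of the color of ab. *)
  have [eaz _] := edges_phi a b'; have [_ ebz] := edges_phi a' b.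
  have [colaz _] := col_phi a b'; have [_ colbz] := col_phi a' b.
  rewrite phib in eaz colaz; rewrite phia in ebz colbz.
  apply: mono_triangle_set3 => //.
  - by apply: full; apply: valP.
  - by rewrite colaz chib.
  - by rewrite colbz chia.
have eqa : a = a'.
  have := eqF (val a); rewrite /F !inE eqxx /= (negbTE (neqAB _ _)) (negbTE (neqAC _ _)).
  by rewrite !orbF => /esym/eqP/val_inj.
have eqb : b = b'.
  have := eqF (val b); rewrite /F !inE eqxx orbT /= (negbTE (neqBC _ _)).
  by rewrite (eq_sym (val b) (val a')) (negbTE (neqAB _ _)) orbF => /esym/eqP/val_inj.
have eqz : z = z'.
  have := eqF (val z); rewrite /F !inE eqxx orbT /= !(eq_sym (val z)).
  rewrite (negbTE (neqAC _ _)) (negbTE (neqBC _ _)) /=.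
  by move/esym/eqP/val_inj.
by rewrite eqa eqb eqz.
Qed.
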